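(* Let $C_5,C_6,C_7$ be real constants, not all zero, let $C=\sqrt{C_5^2+C_6^2+C_7^2}$, and let $u\in\mathbb{R}^4$ be non-zero. Consider the geodesic $c(t)=(a(t),b(t))$ starting at the origin of the sub-Riemannian structure $(\mathcal{H},H,g)$ on the $7$-dimensional quaternionic Heisenberg group given by $$b(t)=\frac1C\sin(Ct)\,u+\frac1C\bigl(1-\cos(Ct)\bigr)v,\qquad a(t)=\frac1{C^2}\bigl(Ct-\sin(Ct)\bigr)w,$$ with $v\in\mathbb{R}^4$ and $w\in\mathbb{R}^3$ determined by $u,C_5,C_6,C_7$ as in the context. Then the time $T=\frac{2\pi}{C}$ is the cut time of $c$.
   Context: The quaternionic Heisenberg group $\mathcal{H}$ is $\mathbb{R}^7$ with coordinates $(a_2,a_3,a_4,b_1,b_2,b_3,b_4)$; writing $b=b_1+b_2I+b_3J+b_4K$ and $\Im(a)=a_2I+a_3J+a_4K$ (quaternions), the multiplication is $(b,\Im(a))\cdot(d,\Im(c))=(b+d,\Im(a)+\Im(c)-\Im(\bar bd))$. The distribution $H$ is spanned by the left-invariant fields $e_1=\partial_{b_1}+b_2\partial_{a_2}+b_3\partial_{a_3}+b_4\partial_{a_4}$, $e_2=\partial_{b_2}-b_1\partial_{a_2}+b_4\partial_{a_3}-b_3\partial_{a_4}$, $e_3=\partial_{b_3}-b_4\partial_{a_2}-b_1\partial_{a_3}+b_2\partial_{a_4}$, $e_4=\partial_{b_4}+b_3\partial_{a_2}-b_2\partial_{a_3}-b_1\partial_{a_4}$, and $g$ is the metric on $H$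 making them orthonormal. The optimal control problem is to minimize the energy $\frac12\int_0^{T'}\sum_{i=1}^4u_i^2\,dt$ among curves with $\dot c=\sum_{i=1}^4u_ie_i$ joining two fixed points in fixed time $T'$. The geodesics from the origin are the curves with $\dot c=\sum_{i=1}^4h_ie_i$, $c(0)=0$, where $h=(h_1,\dots,h_4)^t$ solves $\dot h=\Omega h$, with $$\Omega=\begin{bmatrix}0&-C_5&-C_6&-C_7\\ C_5&0&C_7&-C_6\\ C_6&-C_7&0&C_5\\ C_7&C_6&-C_5&0\end{bmatrix}.$$ Here $u=h(0)$, $v=\frac1C\Omega u$ (so $u,v$ are orthogonal, of the same length, and $h(t)=\cos(Ct)u+\sin(Ct)v$), and, with $w_{ij}=u_iv_j-u_jv_i$, $$w=(w_{21}+w_{34},\ w_{31}+w_{42},\ w_{23}+w_{41})^t.$$ In the formulas $a=(a_2,a_3,a_4)^t$ and $b=(b_1,b_2,b_3,b_4)^t$. The cut time of a geodesic $c$ starting at the origin is the supremum of times $t>0$ such that the restriction of $c$ to $[0,t]$ is a minimizer between its endpoints. *)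

(* Defs.v *)
From HB Require Import structures.
From mathcomp Require Import all_boot all_order all_algebra.
From mathcomp Require Import all_classical all_reals all_analysis.

Set Implicit Arguments.
Unset Strict Implicit.
Unset Printing Implicit Defensive.

Import Order.TTheory GRing.Theory Num.Theory.
Import numFieldNormedType.Exports.

Local Open Scope classical_set_scope.
Local Open Scope ring_scope.

(* Disjoint open intervals: the segments [x i, y i] may share endpoints. *)
Definition abs_continuous (R : realType) (V : normedModType R)
    (f : R -> V) (a b : R) : Prop :=
  forall eps : R, 0 < eps -> exists2 delta : R, 0 < delta &
    forall (n : nat) (x y : 'I_n -> R),
      (forall i, [/\ a <= x i, x i <= y i & y i <= b]) ->
      trivIset [set: 'I_n] (fun i => [set` `]x i, y i[]) ->
      \sum_(i < n) (y i - x i) < delta ->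
      \sum_(i < n) `|f (y i) - f (x i)| < eps.

Section Heisenberg.
Variable R : realType.

Definition vec (n : nat) (s : seq R) : 'cV[R]_n := \col_(i < n) s`_i.

(* [crd x k] is the k-th coordinate of x, counted from 1. *)
Definition crd (n : nat) (x : 'cV[R]_n.+1) (k : nat) : R := x (inord k.-1) 0.

(* Points (a, b) with a = (a_2, a_3, a_4) and b = (b_1, b_2, b_3, b_4), so
   that a_2, a_3, a_4 are the entries 0, 1, 2 of the first component. *)
Local Notation heis := ('cV[R]_3 * 'cV[R]_4)%type.

(* The left-invariant fields e_1, ..., e_4; i : 'I_4 stands for e_(i+1). The
   distribution is their span and the metric makes them orthonormal, so the
   squared speed of \sum_i k_i e_i is \sum_i k_i ^ 2. *)
Definition frame (i : 'I_4) (p : heis) : heis :=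
  let b := crd p.2 in
  [:: (vec 3 [::   b 2%N;   b 3%N;   b 4%N], vec 4 [:: 1; 0; 0; 0]);
      (vec 3 [:: - b 1%N;   b 4%N; - b 3%N], vec 4 [:: 0; 1; 0; 0]);
      (vec 3 [:: - b 4%N; - b 1%N;   b 2%N], vec 4 [:: 0; 0; 1; 0]);
      (vec 3 [::   b 3%N; - b 2%N; - b 1%N], vec 4 [:: 0; 0; 0; 1])]`_i.

(* c is only constrained on [0, T]; the open interval avoids two-sided
   derivatives at the endpoints. *)
Definition horizontal (c : R -> heis) (k : R -> 'cV[R]_4)
    (T : R) : Prop :=
  [/\ abs_continuous c 0 T,
      forall i, measurable_fun `[0, T] (fun s => k s i 0) &
      {ae lebesgue_measure, forall s : R, s \in `]0, T[ ->
        is_derive s 1 c (\sum_(i < 4) k s i 0 *: frame i (c s))}].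

(* Extended-real valued: controls that are not square-integrable have
   infinite energy. *)
Definition energy (T : R) (k : R -> 'cV[R]_4) : \bar R :=
  ((2^-1)%:E *
   \int[lebesgue_measure]_(s in `[0%R, T]) (\sum_(i < 4) k s i 0 ^+ 2)%:E)%E.

Definition minimizer (c : R -> heis) (T : R) : Prop :=
  exists2 k, horizontal c k T &
    forall c' k', horizontal c' k' T -> c' 0 = c 0 -> c' T = c T ->
      (energy T k <= energy T k')%E.

Definition cut_time (c : R -> heis) : \bar R :=
  ereal_sup [set t%:E | t in [set t : R | 0 < t /\ minimizer c t]].

Definition Omega (C5 C6 C7 : R) : 'M[R]_4 :=
  \matrix_(i < 4, j < 4)
    (nth [::] [:: [::  0; - C5; - C6; - C7];
                  [:: C5;    0;   C7; - C6];
                  [:: C6; - C7;    0;   C5];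
                  [:: C7;   C6; - C5;    0]] i)`_j.

Definition wedge (u v : 'cV[R]_4) (i j : nat) : R :=
  crd u i * crd v j - crd u j * crd v i.

Definition wvec (u v : 'cV[R]_4) : 'cV[R]_3 :=
  let w := wedge u v in
  vec 3 [:: w 2%N 1%N + w 3%N 4%N;
            w 3%N 1%N + w 4%N 2%N;
            w 2%N 3%N + w 4%N 1%N].

End Heisenberg.

(* Main.v *)
Require Import Defs.
From mathcomp Require Import all_boot all_order all_algebra.
From mathcomp Require Import all_classical all_reals all_analysis.
From mathcomp Require Import measurable_realfun lra ring.
Set Implicit Arguments. Unset Strict Implicit. Unset Printing Implicit Defensive.
Import Order.TTheory GRing.Theory Num.Theory.
Import numFieldNormedType.Exports.
Local Open Scope classical_set_scope.
Local Open Scope ring_scope.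

(** Write alpha = C / 2, J = Omega / C (a skew matrix with J^2 = -1, and
    v = J u) and Gamma = (C5, C6, C7).  Along a horizontal curve (a, b) with
    control k one has b' = k and a' = wvec b k, and
    Gamma . wvec b k = - <Omega b, k>, so sigma = - Gamma . a / C satisfies
    sigma' = <J b, k>: it is the area swept by b, measured with the complex
    structure J.  The geodesic c runs along circles in the complex line
    spanned by u and v = J u, with squared speed <u, u>.

    The cut time is at least 2 pi / C because c is calibrated on [0, T] when
    C T < 2 pi.  With tau = alpha (s - T / 2), which stays in
    ]-pi/2, pi/2[, there are functions phi = - alpha tan tau,
    psi proportional to (cos (alpha s) u + sin (alpha s) v) / cos tau and chi
    of the time s such that the function
      S (s, a, b) = alpha sigma + phi <b, b> / 2 + <psi, b> + chi
    satisfies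
      <k, k> / 2 - dS/ds = | k - alpha J b - phi b - psi |^2 / 2 >= 0
    along every horizontal curve [calibration_ineq].  Integrating, every
    horizontal curve with the end points of c has energy at least
    S (T, c T) - S (0, 0), and this number is T <u, u> / 2, the energy of c
    [geodesic_energy_le].  The curves are only absolutely continuous, so the
    integration step is the inequality f b - f a <= int g for an absolutely
    continuous f with f' <= g almost everywhere [abs_continuous_le_integral].

    The cut time is at most 2 pi / C because for C t > 2 pi some horizontal
    curve with the end points of c on [0, t] has less energy.  Everything
    takes place in the complex line spanned by u and v, where a curve
    x u + y v lifts with a third coordinate z w, z' = x y' - y x'
    [planar_curve].  One adds to the circle the perturbation
    sin (om s) e^(i alpha s) xi with om in {pi / t, 2 pi / t}.  The constraint
    that the swept area is unchanged is an equation in the complex number xi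
    with an explicit nonzero solution, and the squared speed, in units of
    <u, u>, then integrates to t - |xi|^2 (alpha^2 - om^2) t / 2, which is less
    than t because om < alpha [shorter_planar_loop].  As the derivative of a curve determines its
    control almost everywhere, c itself has energy t <u, u> / 2 with any
    control, so c does not minimize [geodesic_not_minimizer]. *)

(** * Derivatives *)

Lemma is_deriveE (R : realType) (V W : normedModType R) (x v : V) (f : V -> W) (df : W) :
  is_derive x v f df <-> h^-1 *: (f (h *: v + x) - f x) @[h --> 0^'] --> df.
Proof.
split=> [[d <-]//|H].
by apply: DeriveDef; [apply/cvg_ex; exists df|apply: cvg_lim].
Qed.

Lemma is_derive_pair (R : realType) (V W1 W2 : normedModType R) (x v : V)
    (f : V -> W1 * W2) (df : W1 * W2) :
  is_derive x v f df <->
  is_derive x v (fun y => (f y).1) df.1 /\ is_derive x v (fun y => (f y).2) df.2.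
Proof.
rewrite !is_deriveE; split=> [H|[H1 H2]].
  split.
    exact: (cvg_comp _ _ H (cvg_fst (F := nbhs df.1) (G := nbhs df.2))).
  exact: (cvg_comp _ _ H (cvg_snd (F := nbhs df.1) (G := nbhs df.2))).
by case: df H1 H2 => d1 d2 /= H1 H2; exact: cvg_pair H1 H2.
Qed.

Lemma is_derive_mxE (R : realType) (V : normedModType R) m n (x v : V)
    (f : V -> 'M[R]_(m, n)) (df : 'M[R]_(m, n)) :
  is_derive x v f df <-> forall i j, is_derive x v (fun y => f y i j) (df i j).
Proof.
split=> [[d <-] i j|H].
  by rewrite derive_mx // mxE; apply/derivableP; move/derivable_mxP : d.
have d : derivable f x v.
  by apply/derivable_mxP => i j; have [] := H i j.
apply: DeriveDef => //; rewrite derive_mx //; apply/matrixP => i j.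
by rewrite mxE; have [] := H i j.
Qed.

Section pointwise_rules.
Variable R : realType.
Implicit Types (f g : R -> R) (x df dg : R).

Lemma is_derive_addf f g x df dg :
  is_derive x 1 f df -> is_derive x 1 g dg ->
  is_derive x 1 (fun s => f s + g s) (df + dg).
Proof. exact: is_deriveD. Qed.

Lemma is_derive_oppf f x df :
  is_derive x 1 f df -> is_derive x 1 (fun s => - f s) (- df).
Proof. exact: is_deriveN. Qed.

Lemma is_derive_mulf f g x df dg :
  is_derive x 1 f df -> is_derive x 1 g dg ->
  is_derive x 1 (fun s => f s * g s) (df * g x + f x * dg).
Proof.
move=> hf hg; apply: (is_derive_eq (@is_deriveM R R^o f g x 1 df dg hf hg)).
by rewrite /GRing.scale /=; ring.
Qed.

Lemma is_derive_constf (k x : R) : is_derive x 1 (fun=> k) (0 : R).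
Proof. exact: is_derive_cst. Qed.

Lemma is_derive_varf (x : R) : is_derive x 1 (fun s => s) (1 : R).
Proof. exact: is_derive_id. Qed.

Lemma is_derive_sinf f x df :
  is_derive x 1 f df -> is_derive x 1 (fun s => sin (f s)) (cos (f x) * df).
Proof. by move=> hf; apply: (@is_derive1_comp _ sin f). Qed.

Lemma is_derive_cosf f x df :
  is_derive x 1 f df -> is_derive x 1 (fun s => cos (f s)) (- sin (f x) * df).
Proof. by move=> hf; apply: (@is_derive1_comp _ cos f). Qed.

Lemma is_derive_invf f x df : f x != 0 ->
  is_derive x 1 f df -> is_derive x 1 (fun s => (f s)^-1) (- f x ^- 2 * df).
Proof. by move=> f0 hf; apply: is_deriveV. Qed.

Lemma is_derive_congr f x df df' : is_derive x 1 f df -> df = df' -> is_derive x 1 f df'.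
Proof. by move=> ? <-. Qed.

End pointwise_rules.

(** Differentiates along the syntax of an expression.  As is_derive is a class
    whose instances concern operations on functions, instance search is kept out
    of the refinement steps. *)
Ltac derive_rules :=
  first [ notypeclasses refine (is_derive_constf _ _)
        | notypeclasses refine (is_derive_varf _)
        | eassumption
        | notypeclasses refine (is_derive_addf _ _); derive_rules
        | notypeclasses refine (is_derive_oppf _); derive_rules
        | notypeclasses refine (is_derive_mulf _ _); derive_rules
        | notypeclasses refine (is_derive_sinf _); derive_rules
        | notypeclasses refine (is_derive_cosf _); derive_rules ].

Ltac derive_to := notypeclasses refine (is_derive_congr _ _); [derive_rules|cbv beta].

Lemma is_derive_continuous (R : realType) (f df : R -> R) :
  (forall x : R, is_derive x 1 f (df x)) -> continuous f.
Proof.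
move=> hf x; apply/differentiable_continuous/derivable1_diffP.
by have [] := hf x.
Qed.

(** * Absolutely continuous functions and their integrals *)

(** A completeness argument in the form of Cousin's lemma: the supremum of the
    points reached by the induction is reached, and is not below b.  A step has
    its fixed point x at one of its ends, so that it can be controlled by the
    behaviour of a function at x alone. *)
Lemma cousin_induction (R : realType) (a b : R) (P : R -> Prop) :
  a <= b -> P a ->
  (forall x, a <= x <= b -> exists2 r, 0 < r &
     forall y z, a <= y -> y <= z -> z <= b -> x - r < y -> z < x + r ->
       y = x \/ z = x -> P y -> P z) ->
  P b.
Proof.
move=> ab Pa step.
pose A := [set x | a <= x <= b /\ P x].
have Aa : A a by split => //; rewrite lexx.
have hsA : has_sup A by split; [exists a | exists b => x [/andP[]]].
set s := sup A.
have as_ : a <= s by apply: ub_le_sup => //; case: hsA.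
have sb : s <= b by apply: ge_sup; [exists a | move=> x [/andP[]]].
have [r r0 hr] : exists2 r, 0 < r &
     forall y z, a <= y -> y <= z -> z <= b -> s - r < y -> z < s + r ->
       y = s \/ z = s -> P y -> P z by apply: step; rewrite as_.
have [x [/andP[ax xb] Px] srx] := sup_adherent r0 hsA.
have xs : x <= s by apply: ub_le_sup => //; [case: hsA|split; rewrite ?ax].
have Ps : P s by apply: (hr x s) => //; [lra|right].
have [->//|sb'] := eqVneq b s.
have sltb : s < b by rewrite lt_neqAle eq_sym sb' sb.
pose z := Num.min b (s + r / 2).
have zs : s < z by rewrite lt_min sltb/=; lra.
have zb : z <= b by rewrite ge_min lexx.
have zr : z < s + r by rewrite gt_min; apply/orP; right; lra.
have Az : A z.
  split; first by rewrite zb andbT; lra.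
  apply: (hr s z) => //; [exact: ltW|lra|by left].
have : z <= s by apply: ub_le_sup => //; case: hsA.
lra.
Qed.

Lemma derive_le0_straddle (R : realType) (h : R -> R) (x d e : R) :
  is_derive x 1 h d -> d <= 0 -> 0 < e ->
  exists2 r, 0 < r & forall y z, y <= z -> x - r < y -> z < x + r ->
     y = x \/ z = x -> h z - h y <= e * (z - y).
Proof.
move=> [dh vh] d0 e0.
have : (fun k : R => k^-1 *: (h (k *: 1 + x) - h x)) @ 0^' --> (d : R).
  by rewrite -vh; exact: dh.
move=> /cvgrPdist_lt /(_ e e0) [r /= r0 hr].
have key y : y != x -> `|y - x| < r -> (h y - h x) / (y - x) < e.
  move=> yx yr.
  have := hr (y - x); rewrite /= sub0r normrN subr_eq0 => /(_ yr yx).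
  rewrite ltr_norml => /andP[+ _].
  rewrite [_ *: 1]mulr1 subrK /GRing.scale /= mulrC; lra.
exists r => // y z yz xy zx [yx|zx'].
  have [->|nzy] := eqVneq z y; first by rewrite !subrr mulr0.
  have zy : 0 < z - y by rewrite subr_gt0 lt_neqAle eq_sym nzy.
  rewrite -ler_pdivrMr// yx ltW// key//; first by rewrite -yx.
  by rewrite -yx gtr0_norm //; lra.
have [->|nzy] := eqVneq z y; first by rewrite !subrr mulr0.
have zy : 0 < z - y by rewrite subr_gt0 lt_neqAle eq_sym nzy.
rewrite -ler_pdivrMr//.
rewrite -(opprB y z) -(opprB (h y) (h z)) invrN mulrNN zx' ltW// key//.
  by rewrite -zx' eq_sym.
by rewrite -zx' distrC gtr0_norm //; lra.
Qed.

Lemma disjoint_itv_length_le (R : realType) (U : set R) n (p q : 'I_n -> R) :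
  measurable U -> (forall i, p i <= q i) ->
  trivIset [set: 'I_n] (fun i => [set` `]p i, q i[]) ->
  (forall i, [set` `]p i, q i[] `<=` U) ->
  ((\sum_(i < n) (q i - p i))%:E <= lebesgue_measure U)%E.
Proof.
move=> mU pq tI sU.
rewrite -sumEFin.
have -> : (\sum_(i < n) (q i - p i)%:E = 
   \sum_(i < n) lebesgue_measure [set` `]p i, q i[] :> \bar R)%E.
  apply: eq_bigr => i _; rewrite lebesgue_measure_itv /= lte_fin.
  case: ltP => // qp; have -> : p i = q i by apply/eqP; rewrite eq_le pq qp.
  by rewrite subrr.
rewrite -measure_bigsetU_ord //.
apply: le_measure; rewrite ?inE //.
  by apply: bigsetU_measurable.
by rewrite -bigcup_seq /=; apply: bigcup_sub => i _; exact: sU.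
Qed.

(** Outside an open set U of small measure the derivative of f - G is
    nonpositive, so f - G grows by at most eta (z - y) on short intervals; inside
    U one only uses that G does not decrease, so that the growth is at most the
    increment of f, and by absolute continuity these increments have a small sum
    over disjoint intervals in U.  The induction carries the family of intervals
    of U used so far. *)
Lemma abs_continuous_growth (R : realType) (f G : R -> R) (a b : R) :
  a <= b -> abs_continuous f a b ->
  (forall x y, a <= x -> x <= y -> y <= b -> G x <= G y) ->
  {ae lebesgue_measure, forall x : R, x \in `]a, b[ ->
     exists2 d, is_derive x 1 (f - G) d & d <= 0} ->
  f b - f a <= G b - G a.
Proof.
move=> ab acf ndG aefG.
set h : R -> R := f - G.
have hE x : h x = f x - G x by [].
suff : forall e, 0 < e -> h b - h a <= e.
  move=> H; have [|hab] := leP (h b - h a) 0; first by rewrite !hE; lra.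
  by have := H ((h b - h a) / 2) ltac:(by rewrite divr_gt0); lra.
move=> e e0.
pose eta := e / 2 / (b - a + 1).
have eta0 : 0 < eta by rewrite !divr_gt0//; lra.
have [del del0 hdel] := acf (e / 2) ltac:(by rewrite divr_gt0).
(* the end points are added to the exceptional set, as nothing is assumed
   about derivatives there *)
have [N [mN N0 sN]] : lebesgue_measure.-negligible
   (~` [set x : R | x \in `]a, b[ -> exists2 d, is_derive x 1 (f - G) d & d <= 0] 
     `|` ([set a] `|` [set b])).
  apply: negligibleU => //.
  by apply: negligibleU; apply/negligibleP => //; exact: lebesgue_measure_set1.
have Noo : (lebesgue_measure N < +oo)%E by rewrite N0.
have [U [oU NU UN]] := lebesgue_regularity_outer mN Noo del0.
have mU : measurable U by exact: open_measurable.
have Udel : (lebesgue_measure U < del%:E)%E.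
  rewrite -(setDUK NU); apply: le_lt_trans UN.
  apply: le_trans (measureU2 _ _ _) _ => //; first exact: measurableD.
  rewrite [X in (X + _ <= _)%E](_ : _ = 0%E); last exact: N0.
  by rewrite add0e.
(* P x: the growth up to x is bounded by finitely many increments of f over
   disjoint intervals in U, up to eta (x - a) *)
pose P x := exists n (p q : 'I_n -> R), [/\
  forall i, [/\ a <= p i, p i <= q i & q i <= x],
  trivIset [set: 'I_n] (fun i => [set` `]p i, q i[]),
  forall i, [set` `]p i, q i[] `<=` U &
  h x - h a <= \sum_(i < n) `|f (q i) - f (p i)| + eta * (x - a)].
suff [n [p [q [pq tI sU Hle]]]] : P b.
  have lt_del : \sum_(i < n) (q i - p i) < del.
    rewrite -lte_fin; apply: le_lt_trans Udel.
    by apply: disjoint_itv_length_le => // i; case: (pq i).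
  have lt_e := hdel n p q pq tI lt_del.
  have : eta * (b - a) <= e / 2.
    rewrite /eta mulrAC ler_pdivrMr; last lra.
    rewrite ler_wpM2l //; lra.
  lra.
apply: (cousin_induction ab).
  exists 0%N, (fun=> a), (fun=> a); split; try by case.
  by rewrite big_ord0 !subrr mulr0 addr0.
move=> x /andP[ax xb].
have [Ux|Ux] := pselect (U x).
- have [r /= r0 rU] : exists2 r : R, 0 < r & ball x r `<=` U.
    by have := oU x Ux; rewrite nbhs_ballP => -[r r0 ?]; exists r.
  exists r => // y z ay yz zb xy zx _ [n [p [q [pq tI sU Hle]]]].
  have yzU : [set` `]y, z[] `<=` U.
    move=> s /=; rewrite in_itv /= => /andP[ys sz]; apply: rU.
    change (`|x - s| < r); rewrite ltr_norml; apply/andP; split; lra.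
  exists n.+1, (fun i => oapp p y (unlift ord_max i)),
    (fun i => oapp q z (unlift ord_max i)); split.
  + move=> i; case: unliftP => [j _|_] /=; last by [].
    by have [? ? qy] := pq j; split => //; apply: le_trans yz.
  + move=> i j _ _; case: unliftP => [i' ->|->]; case: unliftP => [j' ->|->] //=.
    * by move=> H; congr lift; apply: tI H.
    * move=> [s /= []]; rewrite !in_itv /= => /andP[_ sq] /andP[ys _].
      by have [_ _ qy] := pq i'; have := lt_le_trans (lt_trans ys sq) qy; rewrite ltxx.
    * move=> [s /= []]; rewrite !in_itv /= => /andP[ys _] /andP[_ sq].
      by have [_ _ qy] := pq j'; have := lt_le_trans (lt_trans ys sq) qy; rewrite ltxx.
  + by move=> i; case: unliftP => [j _|_] /=; [exact: sU|].
  + rewrite big_ord_recr /= unlift_none /=.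
    under eq_bigr => i _.
      have -> : widen_ord (leqnSn n) i = lift ord_max i.
        by apply/val_inj; rewrite /= /bump leqNgt ltn_ord.
      rewrite liftK /=; over.
    have := ndG y z ay yz zb; have := ler_norm (f z - f y).
    have : 0 <= eta * (z - y) by rewrite mulr_ge0 ?subr_ge0 // ltW.
    move: Hle; rewrite !hE !mulrBr; lra.
- have [d dfG d0] : exists2 d, is_derive x 1 (f - G) d & d <= 0.
    have xN : ~ N x by move=> /NU.
    have xab : x \in `]a, b[.
      rewrite in_itv /= !lt_neqAle ax xb !andbT; apply/andP; split; apply/eqP => E.
        by apply: xN; apply: sN; right; left.
      by apply: xN; apply: sN; right; right.
    by apply: contrapT => H; apply: xN; apply: sN; left => /= /(_ xab).
  have [r r0 hr] := derive_le0_straddle dfG d0 eta0.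
  exists r => // y z ay yz zb xy zx yzx [n [p [q [pq tI sU Hle]]]].
  exists n, p, q; split => //.
    by move=> i; have [? ? ?] := pq i; split => //; lra.
  by have := hr y z yz xy zx yzx; move: Hle; rewrite -/h !mulrBr; lra.
Qed.

(** One half of the fundamental theorem of calculus.  When the integral is
    finite, its primitive G does not decrease and G' = g almost everywhere by
    Lebesgue differentiation, so abs_continuous_growth applies. *)
Lemma abs_continuous_le_integral (R : realType) (f g : R -> R) (a b : R) :
  a <= b -> abs_continuous f a b ->
  measurable_fun `[a, b] g -> (forall x, 0 <= g x) ->
  {ae lebesgue_measure, forall x : R, x \in `]a, b[ ->
     exists2 d, is_derive x 1 f d & d <= g x} ->
  ((f b - f a)%:E <= \int[lebesgue_measure]_(x in `[a, b]) (g x)%:E)%E.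
Proof.
move=> ab acf mg g0 aef.
have [->|] := eqVneq (\int[lebesgue_measure]_(x in `[a, b]) (g x)%:E)%E +oo%E.
  by rewrite leey.
move=> /negP intg.
have intg' : (\int[lebesgue_measure]_(x in `[a, b]) (g x)%:E < +oo)%E.
  by rewrite ltey; apply/negP.
have ig : lebesgue_measure.-integrable `[a, b] (EFin \o g).
  apply/integrableP; split; first exact/measurable_EFinP.
  by under eq_integral => x _ do rewrite /= ger0_norm //.
pose g1 := g \_ `[a, b].
have g10 x : 0 <= g1 x by rewrite /g1 patchE; case: ifP.
have ig1 : lebesgue_measure.-integrable setT (EFin \o g1).
  by rewrite /g1 -restrict_EFin; apply: (integrable_mkcond _ _).1.
have ig1S y : lebesgue_measure.-integrable `[a, y] (EFin \o g1).
  exact: integrableS ig1.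
have loc := open_integrable_locally openT ig1.
have [loc1 _ _] := loc.
pose G x := (\int[lebesgue_measure]_(t in `[a, x]) (g1 t))%R.
have ndG x y : a <= x -> x <= y -> y <= b -> G x <= G y.
  move=> ax xy yb; rewrite /G /Rintegral; apply: fine_le.
  - exact: integrable_fin_num.
  - exact: integrable_fin_num.
  apply: ge0_subset_integral => //.
  - by apply/measurable_EFinP; apply: measurable_funS loc1.
  - by move=> t _; rewrite lee_fin.
  - by apply: subset_itvl; rewrite bnd_simp.
have -> : (\int[lebesgue_measure]_(x in `[a, b]) (g x)%:E = (G b - G a)%:E)%E.
  rewrite /G set_itv1 Rintegral_set1 subr0 /Rintegral fineK.
    apply: eq_integral => x xab; rewrite /g1 patchE xab //.
  exact: integrable_fin_num.
rewrite lee_fin.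
apply: abs_continuous_growth => //.
have := FTC1 (a := BLeft a) ig1S loc.
apply: filterS2 aef => [|x Hf HG xab].
  exact: (ae_filter_ringOfSetsType lebesgue_measure).
have [d df dg] := Hf xab.
move: (xab); rewrite in_itv /= => /andP[ax xb].
have lt_ax : (BLeft a < BRight x)%E by rewrite /= lte_fin.
have [dG G'] := HG lt_ax.
exists (d - g1 x).
  apply: is_deriveB => //; apply: DeriveDef; first exact: dG.
  by rewrite -G' derive1E.
rewrite /g1 patchE mem_set ?subr_le0 //=.
by rewrite in_itv /= !ltW.
Qed.

(** * Closure properties of absolute continuity *)

Lemma lipschitz_abs_continuous (R : realType) (V : normedModType R) (f : R -> V) (a b K : R) :
  (forall x y, a <= x -> x <= y -> y <= b -> `|f y - f x| <= K * (y - x)) ->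
  abs_continuous f a b.
Proof.
move=> Lf e e0.
have K0 : 0 < `|K| + 1 by have := normr_ge0 K; lra.
exists (e / (`|K| + 1)); first by rewrite divr_gt0.
move=> n x y xy _ lt_del.
apply: (@le_lt_trans _ _ (\sum_(i < n) (`|K| + 1) * (y i - x i))).
  apply: ler_sum => i _; have [ax xy' yb] := xy i.
  apply: le_trans (Lf _ _ ax xy' yb) _.
  rewrite ler_wpM2r ?subr_ge0 //; have := ler_norm K; lra.
by rewrite -mulr_sumr mulrC -ltr_pdivlMr.
Qed.

Lemma C1_lipschitz (R : realType) (f df : R -> R) (a b : R) : a <= b ->
  (forall x, a <= x <= b -> is_derive x 1 f (df x)) ->
  {within `[a, b], continuous df} ->
  exists2 K, 0 <= K & forall x y, a <= x -> x <= y -> y <= b -> `|f y - f x| <= K * (y - x).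
Proof.
move=> ab hf cdf.
have cndf : {within `[a, b], continuous (fun x => `|df x|)}.
  by move=> x; apply: continuous_comp; [exact: cdf|exact: norm_continuous].
have [c cab hc] := EVT_max ab cndf.
exists `|df c| => // x y ax xy yb.
have [||z zxy ->] := @MVT_segment R f df x y xy.
- move=> z; rewrite in_itv /= => /andP[xz zy]; apply: hf.
  apply/andP; split; lra.
- apply: derivable_within_continuous => z; rewrite in_itv /= => /andP[xz zy].
  have : is_derive z 1 f (df z) by apply: hf; apply/andP; split; lra.
  by case.
- rewrite normrM (@ger0_norm _ (y - x)) ?subr_ge0 // ler_wpM2r ?subr_ge0 // hc //.
  by move: zxy; rewrite !in_itv /= => /andP[xz zy]; apply/andP; split; lra.
Qed.

Section ac_algebra.
Variables (R : realType) (a b : R).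
Implicit Types f g : R -> R.
Hypothesis ab : a <= b.

Lemma abs_continuousD f g : abs_continuous f a b -> abs_continuous g a b ->
  abs_continuous (fun x => f x + g x) a b.
Proof.
move=> hf hg e e0.
have e20 : 0 < e / 2 by rewrite divr_gt0.
have [d1 d10 H1] := hf _ e20; have [d2 d20 H2] := hg _ e20.
exists (Num.min d1 d2); first by rewrite lt_min d10.
move=> n x y xy tI; rewrite lt_min => /andP[lt1 lt2].
apply: (@le_lt_trans _ _ (\sum_(i < n) (`|f (y i) - f (x i)| + `|g (y i) - g (x i)|))).
  by apply: ler_sum => i _; rewrite opprD addrACA ler_normD.
by rewrite big_split /= (splitr e) ltrD // ?H1 ?H2.
Qed.

Lemma abs_continuous_continuous f : abs_continuous f a b ->
  {within `[a, b], continuous f}.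
Proof.
move=> hf; apply/subspace_continuousP => x /=; rewrite in_itv /= => /andP[ax xb].
apply/cvgrPdist_lt => e e0.
have [d d0 hd] := hf _ e0.
have step y z : a <= y -> y <= z -> z <= b -> z - y < d -> `|f z - f y| < e.
  move=> ay yz zb zyd.
  have := hd 1%N (fun=> y) (fun=> z); rewrite !big_ord_recl !big_ord0 !addr0.
  by apply => // i j _ _ _; rewrite (ord1 i) (ord1 j).
rewrite near_withinE; apply/nbhs_ballP; exists d => // y xyd.
have {}xyd : `|x - y| < d := xyd; rewrite /= in_itv /= => /andP[ay yb].
have [xy|yx] := leP x y.
  rewrite distrC; apply: step => //.
  by move: xyd; rewrite distrC ger0_norm // subr_ge0.
apply: step => //; first exact: ltW.
by move: xyd; rewrite gtr0_norm // subr_gt0.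
Qed.

Lemma abs_continuous_bounded f : abs_continuous f a b ->
  exists2 K, 0 < K & forall x, a <= x <= b -> `|f x| <= K.
Proof.
move=> hf.
have cnf : {within `[a, b], continuous (fun x => `|f x|)}.
  move=> x; apply: continuous_comp; last exact: norm_continuous.
  exact: abs_continuous_continuous.
have [c cab hc] := EVT_max ab cnf.
exists (`|f c| + 1); first by have := normr_ge0 (f c); lra.
by move=> x xab; have := hc x; rewrite in_itv /= => /(_ xab); lra.
Qed.

Lemma abs_continuousM f g : abs_continuous f a b -> abs_continuous g a b ->
  abs_continuous (fun x => f x * g x) a b.
Proof.
move=> hf hg e e0.
have [K K0 fK] := abs_continuous_bounded hf.
have [L L0 gL] := abs_continuous_bounded hg.
have eL0 : 0 < e / 2 / L by rewrite !divr_gt0.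
have eK0 : 0 < e / 2 / K by rewrite !divr_gt0.
have [d1 d10 H1] := hf _ eL0; have [d2 d20 H2] := hg _ eK0.
exists (Num.min d1 d2); first by rewrite lt_min d10.
move=> n x y xy tI; rewrite lt_min => /andP[lt1 lt2].
apply: (@le_lt_trans _ _ (\sum_(i < n) (L * `|f (y i) - f (x i)| + K * `|g (y i) - g (x i)|))).
  apply: ler_sum => i _; have [ax xy' yb] := xy i.
  have -> : f (y i) * g (y i) - f (x i) * g (x i) =
    (f (y i) - f (x i)) * g (y i) + f (x i) * (g (y i) - g (x i)) by ring.
  apply: le_trans (ler_normD _ _) _; rewrite !normrM lerD //.
    by rewrite mulrC ler_wpM2r // gL // yb (le_trans ax).
  by rewrite ler_wpM2r // fK // ax (le_trans xy').
rewrite big_split /= -!mulr_sumr (splitr e) ltrD //.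
  by rewrite mulrC -ltr_pdivlMr // H1.
by rewrite mulrC -ltr_pdivlMr // H2.
Qed.

End ac_algebra.

Lemma C2_lipschitz (R : realType) (f df ddf : R -> R) (a b : R) : a <= b ->
  (forall x : R, a <= x <= b -> is_derive x 1 f (df x)) ->
  (forall x : R, a <= x <= b -> is_derive x 1 df (ddf x)) ->
  exists2 K, 0 <= K &
    forall x y, a <= x -> x <= y -> y <= b -> `|f y - f x| <= K * (y - x).
Proof.
move=> ab hf hdf; apply: C1_lipschitz hf _ => //.
by apply: derivable_within_continuous => x; rewrite in_itv /= => /hdf[].
Qed.

Lemma C2_abs_continuous (R : realType) (f df ddf : R -> R) (a b : R) : a <= b ->
  (forall x : R, a <= x <= b -> is_derive x 1 f (df x)) ->
  (forall x : R, a <= x <= b -> is_derive x 1 df (ddf x)) ->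
  abs_continuous f a b.
Proof.
move=> ab hf hdf; have [K _] := C2_lipschitz ab hf hdf.
exact: lipschitz_abs_continuous.
Qed.

Lemma abs_continuous_sum (R : realType) n (h : 'I_n -> R -> R) (a b : R) :
  (forall i, abs_continuous (h i) a b) ->
  abs_continuous (fun x => \sum_(i < n) h i x) a b.
Proof.
elim: n h => [|n IH] h hh.
  apply: (lipschitz_abs_continuous (K := 0)) => x y _ _ _.
  by rewrite !big_ord0 subrr normr0 mul0r.
have -> : (fun x => \sum_(i < n.+1) h i x) =
    (fun x => \sum_(i < n) h (widen_ord (leqnSn n) i) x + h ord_max x).
  by apply/funext => x; rewrite big_ord_recr.
by apply: abs_continuousD (hh _); apply: IH => i; exact: hh.
Qed.

Lemma abs_continuous_cst (R : realType) (k a b : R) : abs_continuous (fun=> k) a b.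
Proof.
apply: (lipschitz_abs_continuous (K := 0)) => x y _ _ _.
by rewrite subrr normr0 mul0r.
Qed.

Lemma abs_continuous_dominated (R : realType) (V W : normedModType R) (f : R -> V)
    (g : R -> W) a b :
  (forall x y, `|g y - g x| <= `|f y - f x|) ->
  abs_continuous f a b -> abs_continuous g a b.
Proof.
move=> gf hf e e0; have [d d0 H] := hf e e0.
exists d => // n x y xy tI sd; apply: le_lt_trans (H n x y xy tI sd).
by apply: ler_sum.
Qed.

Lemma abs_continuous_coord (R : realType) (c : R -> 'cV[R]_3 * 'cV[R]_4) a b :
  abs_continuous c a b ->
  (forall i, abs_continuous (fun t => (c t).1 i 0) a b) /\
  (forall i, abs_continuous (fun t => (c t).2 i 0) a b).
Proof.
have mx_le n (A B : 'cV[R]_n) i : `|A i 0 - B i 0| <= `|A - B|.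
  rewrite [leRHS]/Num.Def.normr/= mx_normrE.
  by apply: le_trans; last exact: (le_bigmax _ _ (i, 0)); rewrite !mxE.
move=> hc; split=> i; apply: abs_continuous_dominated hc => x y.
  apply: le_trans (mx_le _ _ _ _) _.
  by rewrite prod_normE /= le_max lexx.
apply: le_trans (mx_le _ _ _ _) _.
by rewrite prod_normE /= le_max lexx orbT.
Qed.

(** * Algebra of the distribution *)

Section algebra.
Variable R : realType.
Implicit Types (b k u v x y : 'cV[R]_4).

Lemma sum_ord4 (V : zmodType) (F : 'I_4 -> V) :
  \sum_(i < 4) F i = F (inord 0) + F (inord 1) + F (inord 2) + F (inord 3).
Proof.
rewrite !big_ord_recl big_ord0 addr0 !addrA.
by congr (F _ + F _ + F _ + F _); apply/val_inj; rewrite /= inordK.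
Qed.

Lemma sum_ord3 (V : zmodType) (F : 'I_3 -> V) :
  \sum_(i < 3) F i = F (inord 0) + F (inord 1) + F (inord 2).
Proof.
rewrite !big_ord_recl big_ord0 addr0 !addrA.
by congr (F _ + F _ + F _); apply/val_inj; rewrite /= inordK.
Qed.

Definition dot n (x y : 'cV[R]_n) : R := \sum_i x i 0 * y i 0.

Lemma dotE x y : dot x y =
  crd x 1 * crd y 1 + crd x 2 * crd y 2 + crd x 3 * crd y 3 + crd x 4 * crd y 4.
Proof. by rewrite /dot sum_ord4. Qed.

Lemma crdD n (x y : 'cV[R]_n.+1) i : crd (x + y) i = crd x i + crd y i.
Proof. by rewrite /crd mxE. Qed.

Lemma crdZ n (a : R) (x : 'cV[R]_n.+1) i : crd (a *: x) i = a * crd x i.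
Proof. by rewrite /crd mxE. Qed.

Lemma crd_Omega C5 C6 C7 x : let O := Omega C5 C6 C7 *m x in
  [/\ crd O 1 = - C5 * crd x 2 - C6 * crd x 3 - C7 * crd x 4,
      crd O 2 = C5 * crd x 1 + C7 * crd x 3 - C6 * crd x 4,
      crd O 3 = C6 * crd x 1 - C7 * crd x 2 + C5 * crd x 4 &
      crd O 4 = C7 * crd x 1 + C6 * crd x 2 - C5 * crd x 3].
Proof.
by split; rewrite /crd mxE sum_ord4 !mxE !inordK //=; ring.
Qed.

Lemma dotC n (x y : 'cV[R]_n) : dot x y = dot y x.
Proof. by apply: eq_bigr => i _; rewrite mulrC. Qed.

Lemma dotDl n (x y z : 'cV[R]_n) : dot (x + y) z = dot x z + dot y z.
Proof. by rewrite /dot -big_split; apply: eq_bigr => i _; rewrite mxE mulrDl. Qed.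

Lemma dotZl n a (x z : 'cV[R]_n) : dot (a *: x) z = a * dot x z.
Proof. by rewrite /dot mulr_sumr; apply: eq_bigr => i _; rewrite mxE mulrA. Qed.

Lemma dotDr n (x y z : 'cV[R]_n) : dot z (x + y) = dot z x + dot z y.
Proof. by rewrite !(dotC z) dotDl. Qed.

Lemma dotZr n a (x z : 'cV[R]_n) : dot z (a *: x) = a * dot z x.
Proof. by rewrite !(dotC z) dotZl. Qed.

Lemma dot_ge0 n (x : 'cV[R]_n) : 0 <= dot x x.
Proof. by apply: sumr_ge0 => i _; rewrite -expr2 sqr_ge0. Qed.

Lemma dot_lin2 n (w a b : 'cV[R]_n) (x y : R) :
  dot w (x *: a + y *: b) = x * dot w a + y * dot w b.
Proof. by rewrite dotDr !dotZr. Qed.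

Lemma dot_gt0 n (x : 'cV[R]_n) : x != 0 -> 0 < dot x x.
Proof.
move=> x0; rewrite lt_neqAle dot_ge0 andbT eq_sym; apply: contraNneq x0 => H.
apply/eqP/matrixP => i j; rewrite (ord1 j) mxE; apply/eqP.
have /psumr_eq0P/(_ H)/(_ i isT)/eqP : forall i : 'I_n, true -> 0 <= x i 0 * x i 0.
  by move=> l _; rewrite -expr2 sqr_ge0.
by rewrite mulf_eq0 orbb.
Qed.

Lemma dot_Omega C5 C6 C7 x y :
  dot (Omega C5 C6 C7 *m x) (Omega C5 C6 C7 *m y) =
  (C5 ^+ 2 + C6 ^+ 2 + C7 ^+ 2) * dot x y.
Proof.
have [x1 x2 x3 x4] := crd_Omega C5 C6 C7 x.
have [y1 y2 y3 y4] := crd_Omega C5 C6 C7 y.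
by rewrite !dotE x1 x2 x3 x4 y1 y2 y3 y4; ring.
Qed.

Lemma dot_Omega_skew C5 C6 C7 x y :
  dot (Omega C5 C6 C7 *m x) y = - dot x (Omega C5 C6 C7 *m y).
Proof.
have [x1 x2 x3 x4] := crd_Omega C5 C6 C7 x.
have [y1 y2 y3 y4] := crd_Omega C5 C6 C7 y.
by rewrite !dotE x1 x2 x3 x4 y1 y2 y3 y4; ring.
Qed.

Lemma dot_Omega_self C5 C6 C7 x : dot (Omega C5 C6 C7 *m x) x = 0.
Proof.
have := dot_Omega_skew C5 C6 C7 x x.
by rewrite [in RHS]dotC => /eqP; rewrite -addr_eq0 -mulr2n mulrn_eq0 => /eqP.
Qed.

(** This is why the coordinate a records areas: the right-hand side is - C times the
    area form <J b, k> of the complex structure J = Omega / C, where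
    C^2 = C5^2 + C6^2 + C7^2. *)
Lemma dot3_wvec C5 C6 C7 b k :
  dot (vec 3 [:: C5; C6; C7]) (wvec b k) = - dot (Omega C5 C6 C7 *m b) k.
Proof.
have [b1 b2 b3 b4] := crd_Omega C5 C6 C7 b.
rewrite dotE b1 b2 b3 b4 /dot sum_ord3 !mxE !inordK //= /wedge; ring.
Qed.

(** wvec is alternating, so on a plane it is the area form times the value on
    a basis: planar curves have planar lifts. *)
Lemma wvec_lin2 (u v : 'cV[R]_4) (x y dx dy : R) :
  wvec (x *: u + y *: v) (dx *: u + dy *: v) = (x * dy - y * dx) *: wvec u v.
Proof.
apply/matrixP => i j; rewrite !mxE.
case: i => -[|[|[|//]]] i3 /=; rewrite /wedge !crdD !crdZ; ring.
Qed.

Lemma frame_sum (k : 'cV[R]_4) (p : 'cV[R]_3 * 'cV[R]_4) :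
  \sum_(i < 4) k i 0 *: frame i p = (wvec p.2 k, k).
Proof.
rewrite sum_ord4 /frame !inordK //= [LHS]surjective_pairing /=; congr (_, _).
  apply/matrixP => i j; rewrite !mxE.
  case: i => -[|[|[|//]]] i3 /=; rewrite /wedge /crd; ring.
apply/matrixP => i j; rewrite !mxE (ord1 j).
case: i => -[|[|[|[|//]]]] i4 /=; rewrite ?mulr1 ?mulr0 ?addr0 ?add0r;
  by congr (k _ _); apply/val_inj; rewrite /= inordK.
Qed.

Lemma is_derive_dot n (f g : R -> 'cV[R]_n) (df dg : 'cV[R]_n) (s : R) :
  (forall i, is_derive s 1 (fun t => f t i 0) (df i 0)) ->
  (forall i, is_derive s 1 (fun t => g t i 0) (dg i 0)) ->
  is_derive s 1 (fun t => dot (f t) (g t)) (dot df (g s) + dot (f s) dg).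
Proof.
move=> hf hg.
have h (i : 'I_n) : is_derive s 1 (fun t => f t i 0 * g t i 0)
    (df i 0 * g s i 0 + f s i 0 * dg i 0).
  by have h1 := hf i; have h2 := hg i; derive_rules.
have := is_derive_sum h.
rewrite fct_sumE big_split.
by apply.
Qed.

Lemma abs_continuous_dot n (f g : R -> 'cV[R]_n) (a b : R) : a <= b ->
  (forall i, abs_continuous (fun t => f t i 0) a b) ->
  (forall i, abs_continuous (fun t => g t i 0) a b) ->
  abs_continuous (fun t => dot (f t) (g t)) a b.
Proof.
move=> ab hf hg; apply: (@abs_continuous_sum R n (fun i t => f t i 0 * g t i 0)) => i.
exact: abs_continuousM.
Qed.

Lemma horizontal_derive (c : R -> 'cV[R]_3 * 'cV[R]_4) (k : 'cV[R]_4) (s : R) :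
  is_derive s 1 c (\sum_(i < 4) k i 0 *: frame i (c s)) <->
  (forall i, is_derive s 1 (fun t => (c t).1 i 0) (wvec (c s).2 k i 0)) /\
  (forall i, is_derive s 1 (fun t => (c t).2 i 0) (k i 0)).
Proof.
rewrite frame_sum is_derive_pair !is_derive_mxE /=.
split=> [[H1 H2]|[H1 H2]]; first by split=> i; [exact: H1|exact: H2].
by split=> i j; rewrite (ord1 j).
Qed.


End algebra.

(** * Energy of horizontal curves *)

Section curves.
Variable R : realType.

Lemma measurable_energy (k : R -> 'cV[R]_4) (T : R) :
  (forall i, measurable_fun `[0, T] (fun s => k s i 0)) ->
  measurable_fun `[0, T] (fun s => \sum_(i < 4) k s i 0 ^+ 2).
Proof.
move=> mk; apply: (@measurable_sum _ _ R _ _ _ (fun i s => k s i 0 ^+ 2)) => i.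
exact: measurable_funX.
Qed.

Lemma energyE (k : R -> 'cV[R]_4) (T : R) :
  (forall i, measurable_fun `[0, T] (fun s => k s i 0)) ->
  energy T k =
  (\int[lebesgue_measure]_(s in `[0%R, T]) (2^-1 * dot (k s) (k s))%:E)%E.
Proof.
move=> mk; rewrite /energy -ge0_integralZl_EFin //.
- by move=> s _; rewrite lee_fin sumr_ge0 // => i _; rewrite sqr_ge0.
- exact: ((measurable_EFinP _ _).2 (measurable_energy mk)).
Qed.

(** The calibration principle: a function f of the time that grows at most as
    fast as the energy bounds the energy from below. *)
Lemma horizontal_energy_ge c (k : R -> 'cV[R]_4) (T : R) (f : R -> R) :
  0 <= T -> horizontal c k T -> abs_continuous f 0 T ->
  {ae lebesgue_measure, forall s : R, s \in `]0, T[ ->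
     is_derive s 1 c (\sum_(i < 4) k s i 0 *: frame i (c s)) ->
     exists2 d, is_derive s 1 f d & d <= 2^-1 * dot (k s) (k s)} ->
  ((f T - f 0)%:E <= energy T k)%E.
Proof.
move=> T0 [_ mk aec] acf aef; rewrite energyE //.
apply: abs_continuous_le_integral => //.
- have m2 : measurable_fun `[0, T] (cst (2^-1 : R)) by exact: measurable_cst.
  exact: (measurable_funM m2 (measurable_energy mk)).
- by move=> s; rewrite mulr_ge0 ?dot_ge0.
- apply: filterS2 aec aef => [|s H1 H2 sT].
    exact: (ae_filter_ringOfSetsType lebesgue_measure).
  exact: (H2 sT (H1 sT)).
Qed.

(** * Curves in the plane spanned by two vectors *)

Section planar.
Variables (x y z dx dy ddx ddy : R -> R) (u v : 'cV[R]_4).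
Hypotheses (hx : forall s : R, is_derive s 1 x (dx s))
  (hy : forall s : R, is_derive s 1 y (dy s))
  (hz : forall s : R, is_derive s 1 z (x s * dy s - y s * dx s))
  (hdx : forall s : R, is_derive s 1 dx (ddx s))
  (hdy : forall s : R, is_derive s 1 dy (ddy s)).

(** The horizontal lift of the plane curve x u + y v: by wvec_lin2 its first
    component stays on the line of wvec u v, and z is the signed area
    x dy - y dx (twice the Euclidean one) swept from the origin. *)
Definition planar_curve s : 'cV[R]_3 * 'cV[R]_4 :=
  (z s *: wvec u v, x s *: u + y s *: v).
Definition planar_control s : 'cV[R]_4 := dx s *: u + dy s *: v.

Lemma planar_derive (s : R) : is_derive s 1 planar_curve
  (\sum_(i < 4) planar_control s i 0 *: frame i (planar_curve s)).
Proof.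
apply/horizontal_derive; split=> i /=.
  rewrite wvec_lin2.
  have h := hz s.
  under eq_fun do rewrite mxE.
  by derive_to; rewrite [RHS]mxE; ring.
have h1 := hx s; have h2 := hy s.
under eq_fun do rewrite !mxE.
by derive_to; rewrite !mxE; ring.
Qed.

Lemma planar_control_measurable (T : R) i :
  measurable_fun `[0, T] (fun s => planar_control s i 0).
Proof.
apply: measurable_funTS; apply: continuous_measurable_fun.
under eq_fun do rewrite !mxE.
apply: (@is_derive_continuous _ _ (fun s => ddx s * u i 0 + ddy s * v i 0)) => s.
have h1 := hdx s; have h2 := hdy s.
by derive_to; ring.
Qed.

(** The derivatives of the coefficients are differentiable, hence continuous,
    so the coefficients are Lipschitz on [0, T]. *)
Lemma planar_horizontal (T : R) : 0 <= T -> horizontal planar_curve planar_control T.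
Proof.
move=> T0; split.
- have [Kx Kx0 Lx] := C2_lipschitz T0 (fun s _ => hx s) (fun s _ => hdx s).
  have [Ky Ky0 Ly] := C2_lipschitz T0 (fun s _ => hy s) (fun s _ => hdy s).
  have hdz (s : R) : is_derive s 1 (fun s => x s * dy s - y s * dx s) 
      (dx s * dy s + x s * ddy s - (dy s * dx s + y s * ddx s)).
    have h1 := hx s; have h2 := hy s; have h3 := hdx s; have h4 := hdy s.
    by derive_to.
  have [Kz Kz0 Lz] := C2_lipschitz T0 (fun s _ => hz s) (fun s _ => hdz s).
  apply: (@lipschitz_abs_continuous _ _ _ _ _
     (Kz * `|wvec u v| + (Kx * `|u| + Ky * `|v|))) => s t s0 st tT.
  have n0 : 0 <= `|wvec u v| by [].
  have u0 : 0 <= `|u| by [].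
  have v0 : 0 <= `|v| by [].
  have bz : `|z t *: wvec u v - z s *: wvec u v| <= Kz * `|wvec u v| * (t - s).
    by rewrite -scalerBl normrZ mulrAC ler_wpM2r // Lz.
  have bx : `|x t *: u - x s *: u| <= Kx * `|u| * (t - s).
    by rewrite -scalerBl normrZ mulrAC ler_wpM2r // Lx.
  have by_ : `|y t *: v - y s *: v| <= Ky * `|v| * (t - s).
    by rewrite -scalerBl normrZ mulrAC ler_wpM2r // Ly.
  rewrite prod_normE /= ge_max; apply/andP; split.
    apply: le_trans bz _; rewrite ler_wpM2r ?subr_ge0 // lerDl.
    by rewrite addr_ge0 // mulr_ge0.
  rewrite opprD addrACA; apply: le_trans (ler_normD _ _) _.
  have : 0 <= Kz * `|wvec u v| * (t - s) by rewrite !mulr_ge0 ?subr_ge0.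
  by rewrite !mulrDl; lra.
- exact: planar_control_measurable.
- by apply: aeW => s _; exact: planar_derive.
Qed.

Lemma planar_energy (T : R) (F : R -> R) : 0 < T -> dot v v = dot u u -> dot u v = 0 ->
  (forall s : R, is_derive s 1 F (dx s ^+ 2 + dy s ^+ 2)) ->
  energy T planar_control = (2^-1 * dot u u * (F T - F 0))%:E.
Proof.
move=> T0 vv uv hF; rewrite energyE; last exact: planar_control_measurable.
pose g s := 2^-1 * dot u u * (dx s ^+ 2 + dy s ^+ 2).
have gE s : 2^-1 * dot (planar_control s) (planar_control s) = g s.
  rewrite /planar_control !(dotDl, dotDr, dotZl, dotZr) (dotC v u) uv vv /g.
  by ring.
under eq_integral => s _ do rewrite gE.
pose G s := 2^-1 * dot u u * F s.
have hG (s : R) : is_derive s 1 G (g s).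
  by have h := hF s; rewrite /G; derive_to; rewrite /g; ring.
rewrite (@continuous_FTC2 _ g G) //.
- by rewrite -EFinB; congr EFin; rewrite /G; ring.
- apply: derivable_within_continuous => s _.
  have h1 := hdx s; have h2 := hdy s.
  have : is_derive s 1 g (2^-1 * dot u u * (2 * dx s * ddx s + 2 * dy s * ddy s)).
    rewrite /g; under eq_fun do rewrite !expr2.
    by derive_to; ring.
  by case.
- have cG := is_derive_continuous hG.
  split; first by move=> s _; have [] := hG s.
    exact/cvg_at_right_filter/cG.
  exact/cvg_at_left_filter/cG.
- by move=> s _; rewrite derive1E; have [] := hG s.
Qed.

End planar.
End curves.

(** * The geodesic minimizes before time 2 pi / C *)

(** The left-hand side is the derivative of the calibrating function along a
    horizontal curve through b with control k, where cs and sn are the cosine and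
    sine of al s, ph = phi and psi = m (cs u + sn v).  The difference of the two
    sides is half the square of the vector r = k - al J b - ph b - psi. *)
Lemma calibration_ineq (R : realType) (C5 C6 C7 C al ph m cs sn : R) (u b k : 'cV[R]_4) :
  let v := C^-1 *: (Omega C5 C6 C7 *m u) in
  C != 0 -> C ^+ 2 = C5 ^+ 2 + C6 ^+ 2 + C7 ^+ 2 -> cs ^+ 2 + sn ^+ 2 = 1 ->
  al * (C^-1 * dot (Omega C5 C6 C7 *m b) k) - 2^-1 * (al ^+ 2 + ph ^+ 2) * dot b b
  + ph * dot b k - (ph * m * cs + al * m * sn) * dot u b + m * cs * dot u k
  + (al * m * cs - ph * m * sn) * dot v b + m * sn * dot v k
  - 2^-1 * dot u u * m ^+ 2 <= 2^-1 * dot k k.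
Proof.
move=> v C0 CE cs1.
pose j := C^-1 *: (Omega C5 C6 C7 *m b).
have jj : dot j j = dot b b.
  by rewrite /j dotZl dotZr dot_Omega -CE; field.
have vv : dot v v = dot u u.
  by rewrite /v dotZl dotZr dot_Omega -CE; field.
have jb : dot j b = 0.
  by rewrite /j dotZl dot_Omega_self mulr0.
have uv : dot u v = 0.
  by rewrite /v dotZr dotC dot_Omega_self mulr0.
have ju : dot j u = - dot v b.
  by rewrite /j /v !dotZl dot_Omega_skew mulrN dotC.
have jv : dot j v = dot u b.
  by rewrite /j /v dotZl dotZr dot_Omega -CE dotC; field.
have jk : C^-1 * dot (Omega C5 C6 C7 *m b) k = dot j k by rewrite dotZl.
rewrite jk; move: jj vv jb uv ju jv; clear jk; clearbody v j => jj vv jb uv ju jv.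
pose r := k + (- al) *: j + (- ph) *: b + (- (m * cs)) *: u + (- (m * sn)) *: v.
have := dot_ge0 r.
rewrite /r !(dotDl, dotDr, dotZl, dotZr).
rewrite (dotC k j) (dotC k b) (dotC k u) (dotC k v) (dotC b j) (dotC u j) (dotC v j).
rewrite (dotC b u) (dotC b v) (dotC v u) jj vv jb uv ju jv.
have -> : m ^+ 2 = m ^+ 2 * cs ^+ 2 + m ^+ 2 * sn ^+ 2.
  by rewrite -mulrDr cs1 mulr1.
move: (dot k k) (dot j k) (dot b b) (dot b k) (dot u b) (dot u k) (dot v b) (dot v k) (dot u u).
clear; move=> kk jk bb bk ub uk vb vk uu; lra.
Qed.

(** The growth of the calibrating function between the end points of the
    geodesic, with U = <u, u>, where al = C / 2, th = C T / 4, c = cos th, s = sin th, and s2, c2,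
    s4, c4 stand for the sines and cosines of 2 th and 4 th given by the
    duplication formulas.  After the cancellation of all the terms containing c2
    and c4 only the term linear in th is left, which is U T / 2. *)
Lemma calibration_total_growth (R : realType) (al s c th U : R) :
  al != 0 -> c != 0 -> c ^+ 2 + s ^+ 2 = 1 ->
  let s2 := c * s *+ 2 in let c2 := c ^+ 2 *+ 2 - 1 in
  let s4 := c2 * s2 *+ 2 in let c4 := c2 ^+ 2 *+ 2 - 1 in
  - (al / (2 * al)) * - ((2 * al)^-1 * (th *+ 2 *+ 2 - s4) * U)
  + - (2^-1 * al) * (s * c^-1) * 
    ((((2 * al)^-1 * s4) ^+ 2 + ((2 * al)^-1 * (1 - c4)) ^+ 2) * U)
  + c * c^-1 * c2 * ((2 * al)^-1 * s4 * U) + c * c^-1 * s2 * ((2 * al)^-1 * (1 - c4) * U)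
  + - ((2 * al)^-1 * U * c ^+ 2) * (s * c^-1)
  - (- ((2 * al)^-1 * U * c ^+ 2) * (- s * c^-1)) = 2^-1 * U * (2 * th / al).
Proof.
move=> al0 c0 tr s2 c2 s4 c4.
rewrite /s4 /c4 /s2.
have c2E : c2 = c ^+ 2 - s ^+ 2 by rewrite /c2 -tr mulr2n; ring.
have c4E : c2 ^+ 2 *+ 2 - 1 = 1 - 8 * s ^+ 2 * c ^+ 2.
  have e1 : c2 ^+ 2 = 1 - 4 * s ^+ 2 * c ^+ 2.
    transitivity ((c ^+ 2 + s ^+ 2) ^+ 2 - 4 * s ^+ 2 * c ^+ 2).
      by rewrite c2E; ring.
    by rewrite tr; ring.
  by rewrite e1 mulr2n; ring.
rewrite c4E c2E !mulr2n.
(* the bracket vanishes because c ^+ 2 + s ^+ 2 = 1 *)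
transitivity (2^-1 * U * (2 * th / al) + U / al * s * c * (- (c ^+ 2 - s ^+ 2)
   - 2 * s ^+ 2 * (c ^+ 2 + s ^+ 2) ^+ 2 + 2 * (c ^+ 2 + s ^+ 2) ^+ 2 - 1)).
  by field; rewrite al0 c0.
have -> : s ^+ 2 = 1 - c ^+ 2 by rewrite -tr; ring.
by ring.
Qed.

Section calibration.
Variable R : realType.
Variables (C5 C6 C7 : R) (u : 'cV[R]_4).
Let C : R := Num.sqrt (C5 ^+ 2 + C6 ^+ 2 + C7 ^+ 2).
Let v : 'cV[R]_4 := C^-1 *: (Omega C5 C6 C7 *m u).
Hypothesis C_gt0 : 0 < C.

Lemma sqr_rotation_rate : C ^+ 2 = C5 ^+ 2 + C6 ^+ 2 + C7 ^+ 2.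
Proof. by rewrite sqr_sqrtr // !addr_ge0 ?sqr_ge0. Qed.

Lemma dot_vv : dot v v = dot u u.
Proof.
by rewrite /v dotZl dotZr dot_Omega -sqr_rotation_rate; field; rewrite gt_eqF.
Qed.

Lemma dot_uv : dot u v = 0.
Proof. by rewrite /v dotZr dotC dot_Omega_self mulr0. Qed.

Lemma dot3_wvec_uv : dot (vec 3 [:: C5; C6; C7]) (wvec u v) = - (C * dot u u).
Proof.
rewrite dot3_wvec -dot_vv {2}/v dotZl.
by congr (- _); field; rewrite gt_eqF.
Qed.

(** The calibrating function alpha sigma + phi <b, b> / 2 + <psi, b> + chi is
    evaluated along the competitor.  Centring tau at T / 2 makes the condition
    C T < 2 pi keep cos tau away from 0 on the whole closed interval, so that
    ic = 1 / cos tau and tn = tan tau are smooth there. *)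
Lemma geodesic_energy_le (T : R) (c' : R -> 'cV[R]_3 * 'cV[R]_4) k' :
  0 < T -> C * T < pi *+ 2 ->
  horizontal c' k' T ->
  c' 0 = 0 ->
  c' T = ((C ^- 2 * (C * T - sin (C * T))) *: wvec u v,
     (C^-1 * sin (C * T)) *: u + (C^-1 * (1 - cos (C * T))) *: v) ->
  ((2^-1 * dot u u * T)%:E <= energy T k')%E.
Proof.
move=> T0 CT hor c'0 c'T.
have T0' := ltW T0.
have Cn0 : C != 0 by rewrite gt_eqF.
pose al := C / 2.
have CE : C = 2 * al by rewrite /al; field.
have al0 : 0 < al by rewrite /al divr_gt0.
have aln0 : al != 0 by rewrite gt_eqF.
pose th := al * T / 2.
have thpi : th < pi / 2.
  by move: CT; rewrite CE (mulr2n pi) /th; lra.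
pose tau s := al * (s - T / 2).
have cos_tau s : 0 <= s <= T -> 0 < cos (tau s).
  move=> /andP[s0 sT]; apply: cos_gt0_pihalf.
  have h1 : al * s <= al * T by rewrite ler_wpM2l // ltW.
  have h2 : 0 <= al * s by rewrite mulr_ge0 // ltW.
  by move: thpi; rewrite /th /tau => h; apply/andP; split; lra.
pose ic s := (cos (tau s))^-1.
pose tn s := sin (tau s) * ic s.
have icE s : 0 <= s <= T -> tn s ^+ 2 = ic s ^+ 2 - 1.
  move=> hs; have := cos_tau s hs; rewrite lt0r => /andP[cn0 _].
  rewrite /tn /ic exprMn sin2cos2; field; exact: cn0.
have dic (s : R) : 0 <= s <= T -> is_derive s 1 ic (al * (tn s * ic s)).
  move=> hs; have := cos_tau s hs; rewrite lt0r => /andP[cn0 _].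
  have h : is_derive s 1 (fun s => cos (tau s)) (- al * sin (tau s)).
    by rewrite /tau; derive_to; ring.
  apply: is_derive_congr (is_derive_invf cn0 h) _.
  by rewrite /tn /ic; field.
have dtn (s : R) : 0 <= s <= T -> is_derive s 1 tn (al * (ic s * ic s)).
  move=> hs; have := cos_tau s hs; rewrite lt0r => /andP[cn0 _].
  have h := dic s hs.
  have h2 : is_derive s 1 (fun s => sin (tau s)) (al * cos (tau s)).
    by rewrite /tau; derive_to; ring.
  change (is_derive s 1 (fun s => sin (tau s) * ic s) (al * (ic s * ic s))); derive_to.
  transitivity (al * (cos (tau s) * ic s) + al * tn s ^+ 2).
    by rewrite /tn; ring.
  by rewrite icE // /ic mulfV //; ring.
have ac_ic : abs_continuous ic 0 T.
  apply: (@C2_abs_continuous _ ic (fun s => al * (tn s * ic s))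
    (fun s => al * (al * (ic s * ic s) * ic s + tn s * (al * (tn s * ic s))))
    0 T T0' dic).
  by move=> s hs; have h1 := dtn s hs; have h2 := dic s hs; derive_to; ring.
have ac_tn : abs_continuous tn 0 T.
  apply: (@C2_abs_continuous _ tn (fun s => al * (ic s * ic s))
    (fun s => al * (2 * (al * (tn s * ic s)) * ic s)) 0 T T0' dtn).
  by move=> s hs; have h2 := dic s hs; derive_to; ring.
have ac_cos : abs_continuous (fun s => cos (al * s)) 0 T.
  apply: (@C2_abs_continuous _ _ (fun s => - al * sin (al * s))
    (fun s => - al * al * cos (al * s))) => // s _.
    by derive_to; ring.
  by derive_to; ring.
have ac_sin : abs_continuous (fun s => sin (al * s)) 0 T.
  apply: (@C2_abs_continuous _ _ (fun s => al * cos (al * s))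
    (fun s => - al * al * sin (al * s))) => // s _.
    by derive_to; ring.
  by derive_to; ring.
pose mu := cos th.
pose Gam : 'cV[R]_3 := vec 3 [:: C5; C6; C7].
pose sg s := dot Gam (c' s).1.
pose N s := dot (c' s).2 (c' s).2.
pose p s := dot u (c' s).2.
pose q s := dot v (c' s).2.
pose S s := - (al / C) * sg s + - (2^-1 * al) * tn s * N s
  + mu * ic s * cos (al * s) * p s + mu * ic s * sin (al * s) * q s
  + - ((2 * al)^-1 * dot u u * mu ^+ 2) * tn s.
have [ac1 ac2] := abs_continuous_coord (let: And3 h _ _ := hor in h).
have ac_c n (x : 'cV[R]_n) (i : 'I_n) : abs_continuous (fun _ : R => x i 0) 0 T.
  exact: abs_continuous_cst.
have acS : abs_continuous S 0 T.
  have a_sg : abs_continuous sg 0 T by exact: abs_continuous_dot.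
  have a_N : abs_continuous N 0 T by exact: abs_continuous_dot.
  have a_p : abs_continuous p 0 T by exact: abs_continuous_dot.
  have a_q : abs_continuous q 0 T by exact: abs_continuous_dot.
  have a_k (k : R) : abs_continuous (fun _ : R => k) 0 T by exact: abs_continuous_cst.
  by repeat (first [assumption | apply: abs_continuousD | apply: (abs_continuousM T0')]).
(* only the end points of the competitor enter here *)
have ST : S T - S 0 = 2^-1 * dot u u * T.
  have [p0 q0 N0 sg0] : [/\ p 0 = 0, q 0 = 0, N 0 = 0 & sg 0 = 0].
    have d0 n (x : 'cV[R]_n) : dot x 0 = 0.
      by apply: big1 => i _; rewrite [X in _ * X]mxE mulr0.
    by rewrite /p /q /N /sg c'0; split; exact: d0.
  have pT : p T = C^-1 * sin (C * T) * dot u u.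
    by rewrite /p c'T /= dot_lin2 dot_uv; ring.
  have qT : q T = C^-1 * (1 - cos (C * T)) * dot u u.
    by rewrite /q c'T /= dot_lin2 dot_vv (dotC v u) dot_uv; ring.
  have NT : N T = ((C^-1 * sin (C * T)) ^+ 2 + (C^-1 * (1 - cos (C * T))) ^+ 2) * dot u u.
    by rewrite /N c'T /= dot_lin2 !(dotC (_ + _)) !dot_lin2 dot_vv (dotC v u) dot_uv; ring.
  have sgT : sg T = - (C^-1 * (C * T - sin (C * T)) * dot u u).
    by rewrite /sg c'T /= dotZr dot3_wvec_uv; field.
  have tauT : tau T = th by rewrite /tau /th; field.
  have tau0 : tau 0 = - th by rewrite /tau /th; field.
  have cth : cos th != 0.
    by have := cos_tau T; rewrite T0' lexx tauT => /(_ isT); rewrite lt0r => /andP[].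
  rewrite /S p0 q0 N0 sg0 pT qT NT sgT /tn /ic tauT tau0 sinN cosN /mu.
  have -> : al * T = th *+ 2 by rewrite /th (mulr2n (_ / _)); field.
  have -> : C * T = (th *+ 2) *+ 2 by rewrite CE /th !(mulr2n (_ / _)) (mulr2n (_ + _)); field.
  have ThE : T = 2 * th / al by rewrite /th; field.
  rewrite (sin_mulr2n (th *+ 2)) (cos_mulr2n (th *+ 2)) (sin_mulr2n th) (cos_mulr2n th).
  have tr := cos2Dsin2 th.
  rewrite CE ThE.
  have := calibration_total_growth th (dot u u) aln0 cth tr.
  by move=> /= <-; ring.
rewrite -ST; apply: horizontal_energy_ge T0' hor acS _.
apply: aeW => s s0T dc'.
have hs : 0 <= s <= T by move: s0T; rewrite in_itv /= => /andP[/ltW -> /ltW ->].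
have /horizontal_derive[d1 d2] := dc'.
set k := k' s in d1 d2 *.
set b := (c' s).2 in d1.
have dcst n (x : 'cV[R]_n) i : is_derive s 1 (fun=> x i 0) ((0 : 'cV[R]_n) i 0).
  by rewrite mxE; exact: is_derive_constf.
have dot0 n (x : 'cV[R]_n) : dot 0 x = 0 by rewrite /dot big1 // => i _; rewrite mxE mul0r.
have dsg : is_derive s 1 sg (- dot (Omega C5 C6 C7 *m b) k).
  have := is_derive_dot (dcst _ Gam) d1.
  by rewrite dot0 add0r dot3_wvec.
have dN : is_derive s 1 N (2 * dot b k).
  apply: is_derive_congr (is_derive_dot d2 d2) _.
  by rewrite -/b (dotC k b); ring.
have dp : is_derive s 1 p (dot u k).
  by have := is_derive_dot (dcst _ u) d2; rewrite dot0 add0r.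
have dq : is_derive s 1 q (dot v k).
  by have := is_derive_dot (dcst _ v) d2; rewrite dot0 add0r.
have h1 := dic s hs; have h2 := dtn s hs.
eexists.
  by rewrite /S; derive_rules.
apply: le_trans (calibration_ineq (C5 := C5) (C6 := C6) (C7 := C7) al (- al * tn s)
  (mu * ic s) u b k Cn0 sqr_rotation_rate (cos2Dsin2 (al * s))).
rewrite -/v -/(p s) -/(q s) -/(N s).
have -> : al ^+ 2 + (- al * tn s) ^+ 2 = al ^+ 2 * ic s ^+ 2.
  by transitivity (al ^+ 2 * (1 + tn s ^+ 2)); [ring|rewrite icE //; ring].
rewrite le_eqVlt; apply/orP; left; apply/eqP.
by field; rewrite Cn0 aln0.
Qed.

End calibration.

(** * A shorter curve after time 2 pi / C *)

Section shorter.
Variable R : realType.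

(** The perturbation sin (om s) e^(i al s) changes the swept area to first order
    if and only if cos (om t) e^(i al t) is not 1.  For om = pi / t this fails
    when al t is an odd multiple of pi; as al t > pi, it is then at least 3 pi and
    om = 2 pi / t is still below al. *)
Lemma perturbation_frequency (al t : R) : 0 < t -> pi < al * t ->
  exists om : R, [/\ 0 < om, om < al, sin (om * t) = 0 &
    cos (om * t) * cos (al * t) != 1].
Proof.
move=> t0 alt; have pi0 := pi_gt0 R.
have t0' : t != 0 by rewrite gt_eqF.
have [c1|c1] := eqVneq (cos (al * t)) (-1); last first.
  exists (pi / t); rewrite divfK // sinpi cospi mulN1r; split => //.
  - by rewrite divr_gt0.
  - by rewrite ltr_pdivrMr.
  - by rewrite -eqr_oppLR in c1.
have alt2 : pi *+ 2 < al * t.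
  rewrite ltNge; apply/negP => alt2.
  have : cos (al * t - pi) < cos 0.
    rewrite mulr2n in alt2.
    by rewrite ltr_cos ?in_itv /=; [lra|apply/andP; split; lra|apply/andP; split; lra].
  by rewrite cosB cospi sinpi cos0 c1; lra.
exists (pi *+ 2 / t); rewrite divfK // sin2pi cos2pi mul1r c1; split => //.
- by rewrite divr_gt0 // pmulrn_lgt0.
- by rewrite ltr_pdivrMr.
- by apply/eqP; lra.
Qed.

(** The circle x0, y0 with swept area z0 is perturbed by
    X + i Y = sin (om s) e^(i al s) (x1 + i x2), which vanishes at both ends.  The
    cross terms of the area and of the energy are, up to boundary terms,
    integrals of sin (om s) cos (al s) and sin (om s) sin (al s), whose primitives
    are P and Q; the quadratic terms need the primitives W and W2 of the squares
    of sin (om s) and cos (om s). *)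
Lemma shorter_planar_loop (C t : R) : 0 < C -> 0 < t -> pi *+ 2 < C * t ->
  exists x y z dx dy ddx ddy F : R -> R,
  [/\ [/\ forall s : R, is_derive s 1 x (dx s), forall s : R, is_derive s 1 y (dy s),
      forall s : R, is_derive s 1 z (x s * dy s - y s * dx s),
      forall s : R, is_derive s 1 dx (ddx s) & forall s : R, is_derive s 1 dy (ddy s)],
   [/\ x 0 = 0, y 0 = 0 & z 0 = 0],
   [/\ x t = C^-1 * sin (C * t), y t = C^-1 * (1 - cos (C * t)) &
       z t = C ^- 2 * (C * t - sin (C * t))],
   forall s : R, is_derive s 1 F (dx s ^+ 2 + dy s ^+ 2) & F t - F 0 < t].
Proof.
move=> C0 t0 Ct.
pose al := C / 2.
have CE : C = 2 * al by rewrite /al; field.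
have al0 : 0 < al by rewrite /al divr_gt0.
have alt : pi < al * t by move: Ct; rewrite CE mulr2n; lra.
have [om [om0 omal som sgc]] := perturbation_frequency t0 alt.
have Cn0 : C != 0 by rewrite gt_eqF.
have aln0 : al != 0 by rewrite gt_eqF.
have omn0 : om != 0 by rewrite gt_eqF.
have tn0 : t != 0 by rewrite gt_eqF.
have Dn0 : (al - om) * (al + om) != 0.
  by rewrite mulf_neq0 // gt_eqF // ?subr_gt0 // addr_gt0.
have D0 : 0 < (al - om) * (al + om).
  by rewrite mulr_gt0 // ?subr_gt0 // addr_gt0.
have mn0 : al - om != 0 by rewrite gt_eqF // subr_gt0.
have pn0 : al + om != 0 by rewrite gt_eqF // addr_gt0.
pose D := (al - om) * (al + om).
pose P s := (om * (cos (om * s) * cos (al * s) - 1) + al * (sin (om * s) * sin (al * s))) * D^-1.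
pose Q s := (om * (cos (om * s) * sin (al * s)) - al * (sin (om * s) * cos (al * s))) * D^-1.
pose W s := s * 2^-1 - sin (om * s) * cos (om * s) * (2 * om)^-1.
pose W2 s := s * 2^-1 + sin (om * s) * cos (om * s) * (2 * om)^-1.
pose x0 s := C^-1 * sin (C * s).
pose y0 s := C^-1 * (1 - cos (C * s)).
pose z0 s := C ^- 2 * (C * s - sin (C * s)).
have dP (s : R) : is_derive s 1 P (sin (om * s) * cos (al * s)).
  by rewrite /P; derive_to; rewrite /D; field; rewrite mn0 pn0.
have dQ (s : R) : is_derive s 1 Q (sin (om * s) * sin (al * s)).
  by rewrite /Q; derive_to; rewrite /D; field; rewrite mn0 pn0.
have trO (s : R) : cos (om * s) ^+ 2 + sin (om * s) ^+ 2 = 1 by rewrite cos2Dsin2.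
have trA (s : R) : cos (al * s) ^+ 2 + sin (al * s) ^+ 2 = 1 by rewrite cos2Dsin2.
have trC (s : R) : cos (C * s) ^+ 2 + sin (C * s) ^+ 2 = 1 by rewrite cos2Dsin2.
have dW (s : R) : is_derive s 1 W (sin (om * s) ^+ 2).
  rewrite /W; derive_to; have := trO s => tr.
  transitivity (2^-1 - 2^-1 * (cos (om * s) ^+ 2 - sin (om * s) ^+ 2)); first by field.
  by lra.
have dW2 (s : R) : is_derive s 1 W2 (cos (om * s) ^+ 2).
  rewrite /W2; derive_to; have := trO s => tr.
  transitivity (2^-1 + 2^-1 * (cos (om * s) ^+ 2 - sin (om * s) ^+ 2)); first by field.
  by lra.
have dx0 (s : R) : is_derive s 1 x0 (cos (C * s)).
  by rewrite /x0; derive_to; field.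
have dy0 (s : R) : is_derive s 1 y0 (sin (C * s)).
  by rewrite /y0; derive_to; field.
have dz0 (s : R) : is_derive s 1 z0 (C^-1 * (1 - cos (C * s))).
  by rewrite /z0; derive_to; field.
(* C = 2 al, so that C s - al s = al s *)
have E1 (s : R) : sin (al * s) = sin (C * s) * cos (al * s) - cos (C * s) * sin (al * s).
  by rewrite -sinB; congr sin; rewrite CE; ring.
have E2 (s : R) : cos (al * s) = cos (C * s) * cos (al * s) + sin (C * s) * sin (al * s).
  by rewrite -cosB; congr cos; rewrite CE; ring.
have Qt : Q t = om * (cos (om * t) * sin (al * t)) * D^-1 by rewrite /Q som; ring.
have Pt : P t = om * (cos (om * t) * cos (al * t) - 1) * D^-1 by rewrite /P som; ring.
have P0 : P 0 = 0 by rewrite /P !mulr0 cos0 sin0; ring.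
have Q0 : Q 0 = 0 by rewrite /Q !mulr0 cos0 sin0; ring.
have Wt : W t = t / 2 by rewrite /W som; ring.
have W2t : W2 t = t / 2 by rewrite /W2 som; ring.
have W0 : W 0 = 0 by rewrite /W !mulr0 sin0; ring.
have W20 : W2 0 = 0 by rewrite /W2 !mulr0 sin0; ring.
have x00 : x0 0 = 0 by rewrite /x0 mulr0 sin0 mulr0.
have y00 : y0 0 = 0 by rewrite /y0 mulr0 cos0 subrr mulr0.
have z00 : z0 0 = 0 by rewrite /z0 !mulr0 sin0 subrr mulr0.
have Ptn0 : P t != 0.
  by rewrite Pt !mulf_neq0 // ?invr_eq0 // subr_eq0.
have n0 : 0 < Q t ^+ 2 + P t ^+ 2.
  by rewrite ltr_wpDl ?sqr_ge0 // lt_neqAle eq_sym expf_neq0 ?sqr_ge0.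
(* The area constraint reads
   2 (x1 Q t - x2 P t) + al (x1 ^+ 2 + x2 ^+ 2) t / 2 = 0; it is solved on the
   line of (- Q t, P t). *)
pose r := 4 / (al * t).
pose x1 := - r * Q t.
pose x2 := r * P t.
pose X s := sin (om * s) * (x1 * cos (al * s) - x2 * sin (al * s)).
pose Y s := sin (om * s) * (x1 * sin (al * s) + x2 * cos (al * s)).
pose dX s := om * cos (om * s) * (x1 * cos (al * s) - x2 * sin (al * s))
  - al * (sin (om * s) * (x1 * sin (al * s) + x2 * cos (al * s))).
pose dY s := om * cos (om * s) * (x1 * sin (al * s) + x2 * cos (al * s))
  + al * (sin (om * s) * (x1 * cos (al * s) - x2 * sin (al * s))).
pose ddX s := - (om * om + al * al) * X s
  - 2 * al * om * cos (om * s) * (x1 * sin (al * s) + x2 * cos (al * s)).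
pose ddY s := - (om * om + al * al) * Y s
  + 2 * al * om * cos (om * s) * (x1 * cos (al * s) - x2 * sin (al * s)).
have hX (s : R) : is_derive s 1 X (dX s) by rewrite /X; derive_to; rewrite /dX; ring.
have hY (s : R) : is_derive s 1 Y (dY s) by rewrite /Y; derive_to; rewrite /dY; ring.
have hdX (s : R) : is_derive s 1 dX (ddX s).
  by rewrite /dX; derive_to; rewrite /ddX /X; ring.
have hdY (s : R) : is_derive s 1 dY (ddY s).
  by rewrite /dY; derive_to; rewrite /ddY /Y; ring.
have X0 : X 0 = 0 by rewrite /X mulr0 sin0 mul0r.
have Y0 : Y 0 = 0 by rewrite /Y mulr0 sin0 mul0r.
have Xt : X t = 0 by rewrite /X som mul0r.
have Yt : Y t = 0 by rewrite /Y som mul0r.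
exists (fun s => x0 s + X s), (fun s => y0 s + Y s).
exists (fun s => z0 s + (x0 s * Y s - y0 s * X s) + 2 * (x1 * Q s - x2 * P s)
   + al * (x1 ^+ 2 + x2 ^+ 2) * W s).
exists (fun s => cos (C * s) + dX s), (fun s => sin (C * s) + dY s).
exists (fun s => - C * sin (C * s) + ddX s), (fun s => C * cos (C * s) + ddY s).
exists (fun s => s + 2 * (cos (C * s) * X s + sin (C * s) * Y s)
  + 2 * C * (x1 * Q s - x2 * P s)
  + (x1 ^+ 2 + x2 ^+ 2) * (om ^+ 2 * W2 s + al ^+ 2 * W s)).
split.
- split=> s; have h1 := dx0 s; have h2 := dy0 s; have h3 := dz0 s;
  have h4 := hX s; have h5 := hY s; have h6 := hdX s; have h7 := hdY s;
  have h8 := dQ s; have h9 := dP s; have h10 := dW s.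
  + by derive_to.
  + by derive_to.
  + derive_to.
    (* multiples of the trigonometric relations, whose sum with the goal is a
       polynomial identity *)
    have e1 := congr1 ( *%R (2 * sin (om * s) * x1)) (E1 s).
    have e2 := congr1 ( *%R (2 * sin (om * s) * x2)) (E2 s).
    have e3 := congr1 ( *%R C^-1) (trC s).
    have e4 := congr1 ( *%R (al * (x1 ^+ 2 + x2 ^+ 2) * sin (om * s) ^+ 2)) (trA s).
    move: e1 e2 e3 e4; rewrite /x0 /y0 /X /Y /dX /dY; clear.
    by lra.
  + by derive_to; ring.
  + by derive_to; ring.
- by rewrite x00 y00 z00 X0 Y0 P0 Q0 W0; split; ring.
- rewrite Xt Yt; split; [by rewrite addr0|by rewrite addr0|].
  rewrite -/(z0 t) Wt /x1 /x2 /r.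
  by field; rewrite tn0 aln0.
- move=> s; have h4 := hX s; have h5 := hY s; have h8 := dQ s; have h9 := dP s;
  have h10 := dW s; have h11 := dW2 s.
  derive_to.
  have e1 := congr1 ( *%R (2 * C * sin (om * s) * x1)) (E1 s).
  have e2 := congr1 ( *%R (2 * C * sin (om * s) * x2)) (E2 s).
  have e3 := trC s.
  have e4 := congr1 ( *%R ((x1 ^+ 2 + x2 ^+ 2) *
    (om ^+ 2 * cos (om * s) ^+ 2 + al ^+ 2 * sin (om * s) ^+ 2))) (trA s).
  move: e1 e2 e3 e4; rewrite /X /Y /dX /dY; clear.
  by lra.
- rewrite X0 Y0 Xt Yt P0 Q0 W0 W20 Wt W2t.
  have r0 : 0 < r by rewrite /r divr_gt0 // mulr_gt0.
  have gain : 0 < 2 * r / al * (Q t ^+ 2 + P t ^+ 2) * D.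
    by apply: mulr_gt0 D0; apply: mulr_gt0 n0; rewrite divr_gt0 // mulr_gt0.
  rewrite -subr_gt0; move: gain; congr (_ < _).
  by rewrite /x1 /x2 /r CE /D; field; rewrite tn0 aln0.
Qed.
End shorter.

(** * The cut time *)

Section geodesic.
Variable R : realType.
Variables (C5 C6 C7 : R) (u : 'cV[R]_4).
Let C : R := Num.sqrt (C5 ^+ 2 + C6 ^+ 2 + C7 ^+ 2).
Let v : 'cV[R]_4 := C^-1 *: (Omega C5 C6 C7 *m u).
Hypothesis C_gt0 : 0 < C.

Let x s := C^-1 * sin (C * s).
Let y s := C^-1 * (1 - cos (C * s)).
Let z s := C ^- 2 * (C * s - sin (C * s)).
Let c := planar_curve x y z u v.
Let h := planar_control (fun s => cos (C * s)) (fun s => sin (C * s)) u v.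

Let Cn0 : C != 0. Proof. by rewrite gt_eqF. Qed.

Let dx (s : R) : is_derive s 1 x (cos (C * s)).
Proof. by rewrite /x; derive_to; field. Qed.
Let dy (s : R) : is_derive s 1 y (sin (C * s)).
Proof. by rewrite /y; derive_to; field. Qed.
Let dz (s : R) : is_derive s 1 z (x s * sin (C * s) - y s * cos (C * s)).
Proof.
rewrite /z /x /y; derive_to.
transitivity (C^-1 * (1 - cos (C * s))); first by field.
transitivity (C^-1 * (cos (C * s) ^+ 2 + sin (C * s) ^+ 2 - cos (C * s))).
  by rewrite cos2Dsin2.
by ring.
Qed.
Let ddx (s : R) : is_derive s 1 (fun s => cos (C * s)) (- C * sin (C * s)).
Proof. by derive_to; ring. Qed.
Let ddy (s : R) : is_derive s 1 (fun s => sin (C * s)) (C * cos (C * s)).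
Proof. by derive_to; ring. Qed.

Let c0 : c 0 = 0.
Proof.
rewrite /c /planar_curve /x /y /z !mulr0 sin0 cos0 !subrr !mulr0 !scale0r addr0 //.
Qed.

Lemma geodesic_minimizer (T : R) : 0 < T -> C * T < pi *+ 2 -> minimizer c T.
Proof.
move=> T0 CT; exists h.
  exact: (planar_horizontal u v dx dy dz ddx ddy (ltW T0)).
move=> c' k' hor e0 eT.
have F (s : R) : is_derive s 1 (fun s => s) (cos (C * s) ^+ 2 + sin (C * s) ^+ 2).
  by rewrite cos2Dsin2; exact: is_derive_varf.
rewrite (planar_energy ddx ddy T0 (dot_vv u C_gt0) (dot_uv C5 C6 C7 u) F) subr0.
apply: (geodesic_energy_le C_gt0 T0 CT hor); first by rewrite e0 c0.
by rewrite eT.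
Qed.

(** The control of c in the definition of a minimizer is arbitrary, but it is
    determined almost everywhere by the derivative of c. *)
Lemma geodesic_not_minimizer (t : R) : 0 < dot u u -> 0 < t ->
  pi *+ 2 < C * t -> ~ minimizer c t.
Proof.
move=> uu t0 Ct [k hor opt].
have [x' [y' [z' [dx' [dy' [ddx' [ddy' [F H]]]]]]]] := shorter_planar_loop C_gt0 t0 Ct.
case: H => -[hx hy hz hdx hdy] [x0 y0 z0] [xt yt zt] hF Ft.
have lower : ((2^-1 * dot u u * t)%:E <= energy t k)%E.
  have -> : 2^-1 * dot u u * t = 2^-1 * dot u u * t - 2^-1 * dot u u * 0.
    by rewrite mulr0 subr0.
  have df (s : R) : 0 <= s <= t ->
      is_derive s 1 (fun s => 2^-1 * dot u u * s) (2^-1 * dot u u).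
    by move=> _; derive_to; ring.
  have ddf (s : R) : 0 <= s <= t -> is_derive s 1 (fun=> 2^-1 * dot u u) (0 : R).
    by move=> _; exact: is_derive_constf.
  have acf := C2_abs_continuous (ltW t0) df ddf.
  apply: (horizontal_energy_ge (ltW t0) hor acf).
  apply: aeW => s _ /horizontal_derive[_ d2].
  have /horizontal_derive[_ e2] := planar_derive u v dx dy dz s.
  have -> : k s = h s.
    apply/matrixP => i j; rewrite (ord1 j).
    by have [_ <-] := d2 i; have [_ <-] := e2 i.
  exists (2^-1 * dot u u); first by derive_to; ring.
  rewrite /h /planar_control dot_lin2 !(dotC (_ + _)) !dot_lin2.
  rewrite dot_vv // (dotC v u) dot_uv.
  rewrite -[leLHS]mulr1 -(cos2Dsin2 (C * s)).
  by rewrite le_eqVlt; apply/orP; left; apply/eqP; ring.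
have := opt _ _ (planar_horizontal u v hx hy hz hdx hdy (ltW t0)).
rewrite c0 /planar_curve x0 y0 z0 !scale0r addr0 => /(_ erefl).
rewrite xt yt zt => /(_ erefl) upper.
have := le_trans lower upper.
rewrite (planar_energy hdx hdy t0 (dot_vv u C_gt0) (dot_uv C5 C6 C7 u) hF) lee_fin.
rewrite ler_pM2l ?mulr_gt0 // => /le_lt_trans /(_ Ft).
by rewrite ltxx.
Qed.

End geodesic.

Theorem corollary2 (R : realType) (C5 C6 C7 : R) (u : 'cV[R]_4)
    (hC : ~ (C5 = 0 /\ C6 = 0 /\ C7 = 0)) (hu : u <> 0) :
  let C : R := Num.sqrt (C5 ^+ 2 + C6 ^+ 2 + C7 ^+ 2) in
  let v : 'cV[R]_4 := C^-1 *: (Omega C5 C6 C7 *m u) in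
  let w : 'cV[R]_3 := wvec u v in
  let a (t : R) : 'cV[R]_3 := (C ^- 2 * (C * t - sin (C * t))) *: w in
  let b (t : R) : 'cV[R]_4 :=
    (C^-1 * sin (C * t)) *: u + (C^-1 * (1 - cos (C * t))) *: v in
  let c (t : R) : 'cV[R]_3 * 'cV[R]_4 := (a t, b t) in
  cut_time c = (2 * pi / C)%:E.
Proof.
move=> C v w a b c.
have C0 : 0 < C.
  rewrite sqrtr_gt0 lt_neqAle !addr_ge0 ?sqr_ge0 // andbT eq_sym; apply/eqP.
  move=> /eqP; rewrite !paddr_eq0 ?addr_ge0 ?sqr_ge0 // !sqrf_eq0.
  by move=> /andP[/andP[/eqP ? /eqP ?] /eqP ?]; exact: hC.
have uu : 0 < dot u u by apply: dot_gt0; exact/eqP.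
apply/eqP; rewrite eq_le; apply/andP; split.
  apply: ge_ereal_sup => _ [t [t0 mt] <-].
  rewrite lee_fin ler_pdivlMr // mulrC leNgt; apply/negP => Ct.
  by apply: geodesic_not_minimizer mt => //; rewrite -mulr_natl.
(* c minimizes on [0, t] for times t below 2 pi / C and arbitrarily close to it;
   the maximum with pi / C keeps them positive *)
apply/lee_subgt0Pr => e e0.
pose t := Num.max (2 * pi / C - e) (pi / C).
have piC : 0 < pi / C by rewrite divr_gt0 // pi_gt0.
apply: (@le_trans _ _ t%:E); first by rewrite -EFinB lee_fin le_max lexx.
apply: ereal_sup_ubound; exists t => //; split.
  by rewrite lt_max piC orbT.
apply: geodesic_minimizer => //; first by rewrite lt_max piC orbT.
rewrite mulrC -ltr_pdivlMr // -mulr_natl gt_max; apply/andP; split; first by lra.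
by rewrite ltr_pdivlMr // divfK ?gt_eqF //; have := pi_gt0 R; lra.
Qed.
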